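(* Let $\psi(\cdot;\theta)$ be the ReLU input convex neural network described in the context, let $\phi_c\in\mathbb{R}$, fix $y$, and consider the problem $$(\mathrm P_{\le})\qquad \min_{z}\; z^TP(y)z+q^T(y)z\quad\text{s.t. } A(y)z=b(y),\; G(y)z\le h(y),\; \psi(z;\theta)\le\phi_c .$$ Consider the outer-approximation iteration in which, at iteration $\nu=1,2,\dots$, $z^{(\nu)}$ is a solution of the master problem $$\begin{aligned}(\mathrm M_\nu)\qquad \min_z\;& z^TP(y)z+q^T(y)z\\ \text{s.t. }\;& A(y)z=b(y),\; G(y)z\le h(y),\\ & \psi(z^{(s)};\theta)+\lambda^{(s),T}(z-z^{(s)})\le\phi_c,\quad s=1,\dots,\nu-1,\end{aligned}$$ where $\lambda^{(s)}\in\partial\psi(z^{(s)};\theta)$ is any subgradient of $\psi(\cdot;\theta)$ at $z^{(s)}$; a new cut is added and the iteration continues as long as $\psi(z^{(\nu)};\theta)>\phi_c$. Assume that $(\mathrm P_\le)$ is feasible and that each master problem is solved to global optimality (i.e. $z^{(\nu)}$ is a global minimizer of $(\mathrm M_\nu)$). Then: (i) each master problem $(\mathrm M_\nu)$ is a relaxation of $(\mathrm P_\le)$ (every feasible point of $(\mathrm P_\le)$ is feasible for $(\mathrm M_\nu)$), and its optimal value is a lower bound on the optimal value of $(\mathrm P_\le)$; (ii) the sequence of master optimal values is monotonically non-decreasing in $\nu$ and bounded above by the optimal value of $(\mathrm P_\le)$; (iii) if, at some iteration $\nu$, $\psi(z^{(\nu)};\theta)\le\phi_c$, then $z^{(\nu)}$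 is a global optimum of $(\mathrm P_\le)$.
   Context: The network $\psi(\cdot;\theta)$ is defined, for $z\in\mathbb{R}^n$ and $k\ge1$, by $x_0=0$, $x_{i+1}=g_i(W_i^x x_i+W_i^z z+b_i)$ for $i=0,\dots,k-1$, and $\psi(z;\theta)=x_k\in\mathbb{R}$, where $W_i^x,W_i^z$ are real matrices and $b_i$ real vectors of compatible dimensions, $W_0^x=0$, $W_i^x\ge0$ elementwise for $i=1,\dots,k-1$, $g_i$ is the elementwise $\operatorname{ReLU}(s)=\max(0,s)$ for $i=0,\dots,k-2$, and $g_{k-1}$ is the identity. $P(y),A(y),G(y)$ are real matrices and $q(y),b(y),h(y)$ real vectors of compatible dimensions depending on the fixed parameter $y$. Vector inequalities are elementwise. $\partial\psi$ is the convex subdifferential with respect to $z$. The optimal value of a problem is the infimum of its objective over its feasible set. *)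

(* Defs.v *)
From mathcomp Require Import all_boot all_order all_algebra.
From mathcomp Require Import all_classical reals constructive_ereal ereal.

Set Implicit Arguments.
Unset Strict Implicit.
Unset Printing Implicit Defensive.

Import Order.TTheory GRing.Theory Num.Theory.
Local Open Scope classical_set_scope.
Local Open Scope ring_scope.

Definition le_mx (R : realType) (m n : nat) (A B : 'M[R]_(m, n)) : Prop :=
  forall i j, A i j <= B i j.

Definition dot (R : realType) (n : nat) (u v : 'cV[R]_n) : R :=
  (u^T *m v) 0 0.

Definition relu (R : realType) (s : R) : R := Num.max 0 s.

(* The families are indexed by all of nat to avoid dependent ordinals; the
   network of depth k only uses the entries i < k (and the widths i <= k).   *)
Record icnn_params (R : realType) (n k : nat) := IcnnParams {
  width : nat -> nat;
  width_out : width k = 1%N;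
  Wx : forall i, 'M[R]_(width i.+1, width i);
  Wz : forall i, 'M[R]_(width i.+1, n);
  bias : forall i, 'cV[R]_(width i.+1)
}.

(* ReLU on layers 0, ..., k - 2 and the identity on layer k - 1. *)
Definition activation (R : realType) (k i : nat) (s : R) : R :=
  if (i.+1 < k)%N then relu s else s.

Fixpoint layer (R : realType) (n k : nat) (theta : icnn_params R n k)
    (z : 'cV[R]_n) (i : nat) : 'cV[R]_(width theta i) :=
  match i with
  | 0%N => 0
  | j.+1 => map_mx (activation k j)
              (Wx theta j *m layer theta z j + Wz theta j *m z + bias theta j)
  end.

Definition icnn (R : realType) (n k : nat) (theta : icnn_params R n k)
    (z : 'cV[R]_n) : R :=
  castmx (width_out theta, erefl 1%N) (layer theta z k) 0 0.

Definition subdifferential (R : realType) (n : nat) (f : 'cV[R]_n -> R)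
    (z : 'cV[R]_n) : set 'cV[R]_n :=
  [set g | forall w, f z + dot g (w - z) <= f w].

Definition quad_obj (R : realType) (n : nat) (P : 'M[R]_n) (q : 'cV[R]_n)
    (z : 'cV[R]_n) : R :=
  (z^T *m P *m z) 0 0 + dot q z.

Definition polyhedron (R : realType) (n p m : nat)
    (A : 'M[R]_(p, n)) (b : 'cV[R]_p) (G : 'M[R]_(m, n)) (h : 'cV[R]_m) :
    set 'cV[R]_n :=
  [set z | A *m z = b /\ le_mx (G *m z) h].

Definition feasible (R : realType) (n : nat) (C : set 'cV[R]_n)
    (psi : 'cV[R]_n -> R) (phi : R) : set 'cV[R]_n :=
  [set z | C z /\ psi z <= phi].

(* Iterations are numbered from 1, so zs 0 and lam 0 are never used; the cuts
   present at iteration nu are those generated at s = 1, ..., nu - 1.        *)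
Definition master_feasible (R : realType) (n : nat) (C : set 'cV[R]_n)
    (psi : 'cV[R]_n -> R) (phi : R) (zs lam : nat -> 'cV[R]_n) (nu : nat) :
    set 'cV[R]_n :=
  [set z | C z /\ forall s, (1 <= s < nu)%N ->
                    psi (zs s) + dot (lam s) (z - zs s) <= phi].

Definition optimal_value (R : realType) (n : nat) (f : 'cV[R]_n -> R)
    (F : set 'cV[R]_n) : \bar R :=
  ereal_inf [set (f z)%:E | z in F].

Definition global_minimizer (R : realType) (n : nat) (f : 'cV[R]_n -> R)
    (F : set 'cV[R]_n) (z : 'cV[R]_n) : Prop :=
  F z /\ forall w, F w -> f z <= f w.

(* Iteration nu takes place iff no earlier iterate met the stopping test. *)
Definition reached (R : realType) (n : nat) (psi : 'cV[R]_n -> R) (phi : R)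
    (zs : nat -> 'cV[R]_n) (nu : nat) : Prop :=
  (1 <= nu)%N /\ forall s, (1 <= s < nu)%N -> phi < psi (zs s).

(* The terms of zs and lam beyond termination are unconstrained. *)
Definition outer_approximation (R : realType) (n : nat) (f : 'cV[R]_n -> R)
    (C : set 'cV[R]_n) (psi : 'cV[R]_n -> R) (phi : R)
    (zs lam : nat -> 'cV[R]_n) : Prop :=
  forall nu, reached psi phi zs nu ->
    global_minimizer f (master_feasible C psi phi zs lam nu) (zs nu) /\
    (phi < psi (zs nu) -> subdifferential psi (zs nu) (lam nu)).

(* Main.v *)
(* By the subgradient inequality, every cut is dominated by [psi] and hence
   keeps all points where [psi <= phi_c]; the master problems are therefore
   nested relaxations.  A master minimizer that satisfies the relaxed
   constraint minimizes over the smaller feasible set as well. *)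

Require Import Defs.
From mathcomp Require Import all_boot all_order all_algebra.
From mathcomp Require Import all_classical reals constructive_ereal ereal.

Import Order.TTheory GRing.Theory Num.Theory.
Local Open Scope classical_set_scope.
Local Open Scope ring_scope.

Lemma optimal_value_antitone (R : realType) (n : nat) (f : 'cV[R]_n -> R)
    (F F' : set 'cV[R]_n) :
  F `<=` F' -> (optimal_value f F' <= optimal_value f F)%E.
Proof. by move=> sub; exact/ereal_inf_le_tmp/image_subset. Qed.

(** [outer_approximation] constrains [zs] and [lam] only at iterations that take place, so using the
    cut from an earlier [s] first requires that [s] itself was reached. *)
Lemma reached_le (R : realType) (n : nat) (psi : 'cV[R]_n -> R) (phi : R)
    (zs : nat -> 'cV[R]_n) (mu nu : nat) :
  (1 <= mu <= nu)%N -> reached psi phi zs nu -> reached psi phi zs mu.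
Proof.
move=> /andP[mu1 mu_nu] [_ nostop]; split=> // s /andP[s1 s_mu].
by apply: nostop; rewrite s1 (leq_trans s_mu).
Qed.

Lemma master_feasible_antitone (R : realType) (n : nat) (C : set 'cV[R]_n)
    (psi : 'cV[R]_n -> R) (phi : R) (zs lam : nat -> 'cV[R]_n) (mu nu : nat) :
  (mu <= nu)%N ->
  master_feasible C psi phi zs lam nu `<=` master_feasible C psi phi zs lam mu.
Proof.
move=> mu_nu z [Cz cuts]; split=> // s /andP[s1 s_mu].
by apply: cuts; rewrite s1 (leq_trans s_mu).
Qed.

Lemma feasible_sub_master (R : realType) (n : nat) (f psi : 'cV[R]_n -> R)
    (C : set 'cV[R]_n) (phi : R) (zs lam : nat -> 'cV[R]_n) (nu : nat) :
  outer_approximation f C psi phi zs lam -> reached psi phi zs nu ->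
  feasible C psi phi `<=` master_feasible C psi phi zs lam nu.
Proof.
move=> oa nu_reached z [Cz psiz]; split=> // s /andP[s1 s_nu].
have s_reached : reached psi phi zs s.
  by apply: reached_le nu_reached; rewrite s1 ltnW.
(* Since iteration [nu] takes place, the stopping test failed at [s < nu]; only then is [lam s]
   known to be a subgradient. *)
have cut_s : phi < psi (zs s) by apply: nu_reached.2; rewrite s1.
(* The subgradient inequality at [zs s], instantiated at [z], bounds the left side of the cut by
   [psi z], which is at most [phi]. *)
exact: le_trans ((oa s s_reached).2 cut_s z) psiz.
Qed.

Theorem proposition4 (R : realType) (n k p m : nat) (k_ge1 : (1 <= k)%N)
  (theta : icnn_params R n k)
  (Wx_0 : Wx theta 0%N = 0)
  (Wx_ge0 : forall i, (1 <= i < k)%N -> le_mx 0 (Wx theta i))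
  (phi_c : R)
  (Y : Type) (y : Y)
  (P : Y -> 'M[R]_n) (q : Y -> 'cV[R]_n)
  (A : Y -> 'M[R]_(p, n)) (b : Y -> 'cV[R]_p)
  (G : Y -> 'M[R]_(m, n)) (h : Y -> 'cV[R]_m)
  (zs lam : nat -> 'cV[R]_n) :
  let psi := icnn theta in
  let f := quad_obj (P y) (q y) in
  let C := polyhedron (A y) (b y) (G y) (h y) in
  let F := feasible C psi phi_c in
  let M := master_feasible C psi phi_c zs lam in
  F !=set0 ->
  outer_approximation f C psi phi_c zs lam ->
  (forall nu, reached psi phi_c zs nu ->
     F `<=` M nu /\ (optimal_value f (M nu) <= optimal_value f F)%E) /\
  ((forall mu nu, (1 <= mu <= nu)%N -> reached psi phi_c zs nu ->
      (optimal_value f (M mu) <= optimal_value f (M nu))%E) /\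
   (forall nu, reached psi phi_c zs nu ->
      (optimal_value f (M nu) <= optimal_value f F)%E)) /\
  (forall nu, reached psi phi_c zs nu ->
     psi (zs nu) <= phi_c -> global_minimizer f F (zs nu)).
Proof.
move=> psi f C F M _ oa.
have sub nu : reached psi phi_c zs nu -> F `<=` M nu.
  exact: feasible_sub_master oa.
have bound nu : reached psi phi_c zs nu ->
    (optimal_value f (M nu) <= optimal_value f F)%E.
  by move=> /sub; exact: optimal_value_antitone.
split; first by move=> nu nu_reached; split; [exact: sub | exact: bound].
split; first split=> //.
  move=> mu nu /andP[_ mu_nu] _.
  (* Two order reversals compose: more cuts shrink the feasible set, and a smaller set has a larger
     infimum. *)
  exact/optimal_value_antitone/master_feasible_antitone.
move=> nu nu_reached psi_le.
(* Feasibility of [zs nu] combines [Cz] with the stopping test [psi_le]; its minimality over [M nu]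
   restricts to the subset [F]. *)
have [[[Cz _] z_min] _] := oa nu nu_reached.
by split=> [|w Fw]; [split | apply/z_min/sub].
Qed.
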